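(* Let $\mathcal F$ be a class of functions from $\mathcal R$ to $\mathbb R$ that is closed under pairwise addition and scalar multiplication. Let $x(\cdot)=(x_1(\cdot),\ldots,x_p(\cdot))^\top:\mathcal R\to\mathbb R^p$ denote a realization of the exposure process $X(\cdot)$. Then, given $X(\cdot)=x(\cdot)$, the partially linear model $$Y(s)=x(s)^\top\beta^*+g(s)+\epsilon(s),\qquad s\in\mathcal R,$$ has a unique solution in $\mathbb R^p\times\mathcal F$, in the sense that there is only one pair $(\beta^*,g(\cdot))\in\mathbb R^p\times\mathcal F$ for which the data $Y(s)$ have the distribution given by this model for all $s\in\mathcal R$, if and only if $x(\cdot)^\top a\notin\mathcal F$ for all nonzero $a\in\mathbb R^p$.
   Context: $\mathcal R\subset\mathbb R^d$ is a convex and compact spatial domain. In the model, $\{\epsilon(s)\}_{s\in\mathcal R}$ are i.i.d. with $E(\epsilon(s))=0$, $\mathrm{var}(\epsilon(s))<\infty$, and $\epsilon(\cdot)$ is independent of $X(\cdot)$. It is understood that the data are generated by the model with some true pair $(\beta^*,g(\cdot))\in\mathbb R^p\times\mathcal F$ (so $\mathcal F$ is nonempty); the question is whether any other pair in $\mathbb R^p\times\mathcal F$ gives the same distribution of $Y(s)$ for all $s\in\mathcal R$. Here $x(\cdot)^\top a$ denotes the function $s\mapsto x(s)^\top a$. *)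

(* Defs.v *)
From HB Require Import structures.
From mathcomp Require Import all_boot all_order all_algebra finmap.
From mathcomp Require Import all_classical all_reals all_analysis.
From mathcomp Require Import measurable_realfun.

Set Implicit Arguments.
Unset Strict Implicit.
Unset Printing Implicit Defensive.

Import Order.TTheory GRing.Theory Num.Theory.
Import numFieldNormedType.Exports.

Local Open Scope classical_set_scope.
Local Open Scope ring_scope.

Section probability.
Context {dT : measure_display} {T : measurableType dT} {R : realType}.
Variable P : probability T R.

(* A measure is a total function on [set R], unspecified outside the measurable
   sets, so laws are compared on measurable sets only. *)
Definition same_law (mu nu : set R -> \bar R) : Prop :=
  forall B : set R, measurable B -> mu B = nu B.

Definition mutually_independent (I : choiceType) (Z : I -> {RV P >-> R}) : Prop :=
  forall (J : {fset I}) (B : I -> set R), (forall i, measurable (B i)) ->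
    P (\bigcap_(i in [set` J]) Z i @^-1` B i)
    = (\prod_(i <- J) P (Z i @^-1` B i))%E.

Definition iid (I : choiceType) (Z : I -> {RV P >-> R}) : Prop :=
  mutually_independent Z /\
  forall i j, same_law (distribution P (Z i)) (distribution P (Z j)).

Definition process_sigma (I : Type) (Z : I -> {RV P >-> R}) : set (set T) :=
  <<s \bigcup_i preimage_set_system setT (Z i) measurable >>.

Definition independent_processes (I J : Type)
    (Z : I -> {RV P >-> R}) (W : J -> {RV P >-> R}) : Prop :=
  forall A B : set T, process_sigma Z A -> process_sigma W B ->
    P (A `&` B) = (P A * P B)%E.

End probability.

Section partially_linear_model.
Context {dT : measure_display} {T : measurableType dT} {R : realType}.
Context {P : probability T R} {S : choiceType} {p : nat}.

Definition regressor (x : S -> 'cV[R]_p) (a : 'cV[R]_p) : S -> R :=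
  fun s => ((x s)^T *m a) 0 0.

Definition sample_path (X : S * 'I_p -> {RV P >-> R}) (w : T) : S -> 'cV[R]_p :=
  fun s => \col_j X (s, j) w.

Definition response (eps : S -> {RV P >-> R}) (x : S -> 'cV[R]_p)
    (b : 'cV[R]_p) (g : S -> R) (s : S) : T -> R :=
  fun w => regressor x b s + g s + eps s w.

Lemma measurable_response eps x b g s :
  measurable_fun setT (response eps x b g s).
Proof. exact: measurable_funD. Qed.

HB.instance Definition _ eps x b g s :=
  isMeasurableFun.Build _ _ _ _ (response eps x b g s)
    (measurable_response eps x b g s).

(* Law of Y(s) given X(.) = x(.) under the pair (b, g). Since eps is independent
   of X, this is the law of the response with X frozen at x; [response_lawP]
   checks that it is a version of the conditional law of Y(s) given X(.). A
   conditional law is only determined up to a null set of realizations; this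
   version is the one that makes sense for every realization x. *)
Definition response_law (eps : S -> {RV P >-> R}) (x : S -> 'cV[R]_p)
    (b : 'cV[R]_p) (g : S -> R) (s : S) : probability R R :=
  distribution P (response eps x b g s).

Definition plm_solution (eps : S -> {RV P >-> R}) (x : S -> 'cV[R]_p)
    (F : set (S -> R)) (mu : S -> probability R R)
    (bg : 'cV[R]_p * (S -> R)) : Prop :=
  F bg.2 /\ forall s, same_law (mu s) (response_law eps x bg.1 bg.2 s).

Lemma process_sigma_measurable (I : Type) (Z : I -> {RV P >-> R}) (A : set T) :
  process_sigma Z A -> measurable A.
Proof.
apply: smallest_sub; first exact: (@sigma_algebra_measurable _ T).
move=> _ [i _ [B mB <-]]; rewrite setTI; exact: measurable_funPTI.
Qed.

Lemma response_lawP (X : S * 'I_p -> {RV P >-> R}) (eps : S -> {RV P >-> R})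
    (b : 'cV[R]_p) (g : S -> R) (s : S) (A : set T) (B : set R) :
  independent_processes X eps -> process_sigma X A -> measurable B ->
  P (A `&` [set w | B (response eps (sample_path X w) b g s w)])
  = (\int[P]_(w in A) response_law eps (sample_path X w) b g s B)%E.
Proof.
move=> indep sA mB.
pose TX := g_sigma_algebraType
  (\bigcup_i preimage_set_system setT (X i) measurable).
have mid : measurable_fun setT (id : T -> TX).
  by move=> _ C sC; rewrite setTI; exact: process_sigma_measurable sC.
pose idX : {mfun T >-> TX} :=
  HB.pack (id : T -> TX) (isMeasurableFun.Build _ _ _ _ _ mid).
pose pr : T -> TX * R := fun w => (w, eps s w).
have mpr : measurable_fun setT pr.
  by apply/measurable_fun_pairP; split => //; exact: measurable_funPT.
pose prX : {mfun T >-> (TX * R)%type} :=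
  HB.pack pr (isMeasurableFun.Build _ _ _ _ _ mpr).
pose mu1 := distribution P idX; pose mu2 := distribution P (eps s).
have mX : forall i, measurable_fun setT (X i : TX -> R).
  move=> i _ C mC; rewrite setTI; apply: sub_sigma_algebra.
  by exists i => //; exists C => //; rewrite setTI.
have mlin : measurable_fun setT (fun w : TX => regressor (sample_path X w) b s).
  have -> : (fun w : TX => regressor (sample_path X w) b s)
      = fun w => \sum_j X (s, j) w * b j 0.
    by apply/funext => w; rewrite /regressor mxE; apply: eq_bigr => j _; rewrite !mxE.
  apply: measurable_sum => j; apply: measurable_funM => //; exact: mX.
pose f (z : TX * R) := regressor (sample_path X z.1) b s + g s + z.2.
have mf : measurable_fun setT f.
  apply: measurable_funD => //; apply: measurable_funD => //.
  exact: (measurableT_comp mlin).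
have mA : measurable (A : set TX) by [].
pose E : set (TX * R) := (A `*` setT) `&` f @^-1` B.
have mE : measurable E.
  apply: measurableI; first exact: measurableX.
  by rewrite -[X in measurable X]setTI; exact: mf.
have -> : A `&` [set w | B (response eps (sample_path X w) b g s w)]
    = pr @^-1` E.
  by apply/seteqP; split => w /=; rewrite /E/=; [case=> ? ?|case=> -[? _] ?].
have <- : (mu1 \x mu2)%E E = P (pr @^-1` E).
  apply: (product_measure_unique (m' := distribution P prX)) => // C D mC mD.
  apply: indep => //.
  apply: sub_sigma_algebra; exists s => //; exists D => //.
  by rewrite setTI.
rewrite /product_measure1/= ge0_integral_pushforward//=; last first.
  exact: measurable_fun_xsection.
rewrite preimage_setT [RHS]integral_mkcond; apply: eq_integral => w _ /=.
rewrite patchE; case: ifPn => [/set_mem Aw|/negP Aw].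
  congr (P _); apply/seteqP; split => u /=; rewrite /xsection/= in_setE /E/=.
    by case.
  by move=> ?; split.
have -> : xsection E w = set0.
  apply/seteqP; split => // u; rewrite /xsection/= in_setE => -[[/= Aw' _] _].
  by apply: Aw; rewrite in_setE.
exact: measure0.
Qed.

End partially_linear_model.

(* Main.v *)
(* Distinct deterministic shifts of a random variable have distinct laws, since
   otherwise its cdf would be periodic, hence constant by monotonicity. So the
   laws of the Y(s) determine the function x^T b + g pointwise. The question is
   thus whether the sum of {x^T a | a} and F is direct and a |-> x^T a injective;
   both failures amount to a nonzero a with x^T a in F, the second because 0 is
   in F. *)
Require Import Defs.
From mathcomp Require Import all_boot all_order all_algebra finmap.
From mathcomp Require Import all_classical all_reals all_analysis.

Set Implicit Arguments.
Unset Strict Implicit.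
Unset Printing Implicit Defensive.

Import Order.TTheory GRing.Theory Num.Theory.
Import numFieldNormedType.Exports.

Local Open Scope classical_set_scope.
Local Open Scope ring_scope.

(** A constant cdf cannot have both limits, 0 at [-oo] and 1 at [+oo]. *)
Lemma cdf_not_periodic (dT : measure_display) (T : measurableType dT)
  (R : realType) (P : probability T R) (Z : {RV P >-> R}) (h : R) :
  0 < h -> ~ (forall t, cdf Z (t + h) = cdf Z t).
Proof.
move=> h0 period.
have periodn t n : cdf Z (t + h *+ n) = cdf Z t.
  by elim: n => [|n IHn]; rewrite ?mulr0n ?addr0// mulrSr addrA period.
(* No order between [t] and [u] is assumed: enough periods carry [t] beyond [u]. Exchanging the two
   then gives equality. *)
have le_cdf t u : (cdf Z u <= cdf Z t)%E.
  have [n un] : exists n : nat, u <= t + h *+ n.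
    (* The absolute value provides the nonnegative argument that the Archimedean bound requires. *)
    have := archi_boundP (normr_ge0 ((u - t) / h)).
    set n := Num.bound _ => ltn; exists n.
    rewrite -lerBlDl -mulr_natl -ler_pdivrMr//.
    exact: le_trans (ler_norm _) (ltW ltn).
  by rewrite -(periodn t n); exact: cdf_nondecreasing.
have cdfE : cdf Z = cst (cdf Z 0).
  by apply/funext => t; apply/eqP; rewrite eq_le !le_cdf.
have cdf1 : cdf Z 0 = 1%E.
  by have := @cvg_cdfy1 _ _ _ _ Z; rewrite cdfE => /cvg_lim <-//; rewrite lim_cst.
have cdf0 : cdf Z 0 = 0%E.
  by have := @cvg_cdfNy0 _ _ _ _ Z; rewrite cdfE => /cvg_lim <-//; rewrite lim_cst.
by move/eqP: cdf1; rewrite cdf0 eq_sym onee_eq0.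
Qed.

Lemma regressorD (R : realType) (S : choiceType) (p : nat) (x : S -> 'cV[R]_p)
  (a b : 'cV[R]_p) (s : S) :
  regressor x (a + b) s = regressor x a s + regressor x b s.
Proof. by rewrite /regressor mulmxDr mxE. Qed.

Lemma regressorB (R : realType) (S : choiceType) (p : nat) (x : S -> 'cV[R]_p)
  (a b : 'cV[R]_p) (s : S) :
  regressor x (a - b) s = regressor x a s - regressor x b s.
Proof. by rewrite /regressor mulmxBr !mxE. Qed.

Lemma response_law_inj (dT : measure_display) (T : measurableType dT)
  (R : realType) (P : probability T R) (S : choiceType) (p : nat)
  (eps : S -> {RV P >-> R}) (x : S -> 'cV[R]_p) (b b' : 'cV[R]_p)
  (g g' : S -> R) (s : S) :
  same_law (response_law eps x b g s) (response_law eps x b' g' s) ->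
  regressor x b s + g s = regressor x b' s + g' s.
Proof.
have response_cdf c h t : response_law eps x c h s `]-oo, t]%classic
    = cdf (eps s) (t - (regressor x c s + h s)).
  rewrite /response_law /cdf /distribution/= /pushforward.
  congr (P _); apply/seteqP; split => w /=; rewrite /response !in_itv/=;
    by rewrite lerBrDl.
(* [same_law] is symmetric, so one inequality suffices. Were it false, the positive gap between the
   two shifts would be a period of the cdf of [eps s]. *)
have shift_ge c h c' h' :
    same_law (response_law eps x c h s) (response_law eps x c' h' s) ->
    regressor x c' s + h' s <= regressor x c s + h s.
  move=> eq_law; rewrite leNgt; apply/negP; rewrite -subr_gt0.
  move/(@cdf_not_periodic _ _ _ _ (eps s)); apply=> t.
  (* At this endpoint the second law gives the cdf of [eps s] at [t], the first its value at [t]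
     plus the gap. *)
  have /(_ (measurable_itv _)) := eq_law `]-oo, t + (regressor x c' s + h' s)]%classic.
  by rewrite !response_cdf addrK -addrA.
move=> eq_law; apply/eqP; rewrite eq_le; apply/andP; split; apply: shift_ge => //.
by move=> B mB; rewrite eq_law.
Qed.

Lemma eq_response_law (dT : measure_display) (T : measurableType dT)
  (R : realType) (P : probability T R) (S : choiceType) (p : nat)
  (eps : S -> {RV P >-> R}) (x : S -> 'cV[R]_p) (b b' : 'cV[R]_p)
  (g g' : S -> R) (s : S) :
  regressor x b s + g s = regressor x b' s + g' s ->
  same_law (response_law eps x b g s) (response_law eps x b' g' s).
Proof.
move=> eq_mean B _; rewrite /response_law /distribution/= /pushforward.
congr (P _); apply/seteqP; split => w /=;
  by rewrite /response eq_mean.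
Qed.

Theorem proposition1 (R : realType) (d p : nat)
  (D : set 'rV[R]_d) (D_convex : convex_set D) (D_compact : compact D)
  (dT : measure_display) (T : measurableType dT) (P : probability T R)
  (X : D * 'I_p -> {RV P >-> R}) (eps : D -> {RV P >-> R})
  (eps_iid : iid eps)
  (eps_mean : forall s, ('E_P[eps s] = 0)%E)
  (eps_var : forall s, ('V_P[eps s] < +oo)%E)
  (X_eps_indep : independent_processes X eps)
  (F : set (D -> R))
  (F_add : forall f h : D -> R, F f -> F h -> F (fun s => f s + h s))
  (F_scale : forall (c : R) (f : D -> R), F f -> F (fun s => c * f s))
  (x : D -> 'cV[R]_p) (x_realization : exists w : T, x = sample_path X w)
  (bstar : 'cV[R]_p) (gstar : D -> R) (gstar_F : F gstar) :
  (exists! bg : 'cV[R]_p * (D -> R),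
     plm_solution eps x F (response_law eps x bstar gstar) bg)
  <-> (forall a : 'cV[R]_p, a != 0 -> ~ F (regressor x a)).
Proof.
have sol_star : plm_solution eps x F (response_law eps x bstar gstar) (bstar, gstar).
  by split.
split=> [[bg [_ uniq_bg]] a a0 Fa|notF].
  (* Moving [regressor x a] from the [F] part to the linear part keeps the sum. The factor [-1]
     expresses subtraction through [F_add] and [F_scale]. *)
  have : plm_solution eps x F (response_law eps x bstar gstar)
      (bstar + a, fun s => gstar s + (-1) * regressor x a s).
    split=> [|s]; first by apply: F_add => //; exact: F_scale.
    apply: eq_response_law => /=.
    by rewrite regressorD mulN1r addrACA subrr addr0.
  (* Both solutions equal [bg], so [bstar + a = bstar], against [a != 0]. *)
  move=> /uniq_bg bgE; move: (uniq_bg _ sol_star); rewrite bgE => -[/eqP].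
  by rewrite -subr_eq0 addrAC subrr add0r (negPf a0).
exists (bstar, gstar); split=> // -[b g] [/= Fg law_bg].
have meanE s := response_law_inj (law_bg s).
have bE : b = bstar.
  (* Otherwise [notF] applies to [b - bstar], whose regressor is [gstar - g] by [meanE] and hence
     lies in [F]. *)
  apply/eqP; rewrite -subr_eq0; apply/negP => /negP /notF; apply.
  have -> : regressor x (b - bstar) = fun s => gstar s + (-1) * g s.
    apply/funext => s; rewrite regressorB mulN1r; apply/eqP.
    by rewrite subr_eq addrAC eq_sym subr_eq [gstar s + _]addrC meanE.
  by apply: F_add => //; exact: F_scale.
congr pair; first by rewrite bE.
by apply/funext => s; move: (meanE s); rewrite bE => /addrI.
Qed.
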